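(* Let $\mathscr{T}$ be a finite rooted tree with root $\rho$, set of leaves $\mathscr{L}$ and $|\mathrm{ch}(\rho)|\ge2$, let $\mathbf{V}=(V_\lambda)_{\lambda\in\mathscr{L}}$ with $V_\lambda=\mathbb{C}^{d_\lambda}$, and let $\mathbf{r}=(r_v)_{v\in\mathscr{T}\setminus\{\rho\}}$ be an admissible rank sequence. Let $T$ be the spaced tree associated to $(\mathscr{T},\mathbf{V},\mathbf{r})$ (as constructed in the context). Then the tree tensor network variety and the general Markov model on $T$ coincide as projective varieties: $$\mathrm{TTN}_{\mathscr{T},\mathbf{V},\mathbf{r}}=\mathcal{V}_T .$$
   Context: Tree: $\mathscr{T}$ is a finite rooted tree with root $\rho$ (also denoting its vertex set). $\mathrm{ch}(v)$ is the set of children of $v$. Leaves $\mathscr{L}$ are vertices without children; $\mathscr{N}=\mathscr{T}\setminus\mathscr{L}\ni\rho$. Internal nodes may have any number $\ge1$ of children, but $|\mathrm{ch}(\rho)|\ge2$. Data: $V_\lambda=\mathbb{C}^{d_\lambda}$, $d_\lambda$ a positive integer; $W=\bigotimes_{\lambda\in\mathscr{L}}V_\lambda$. A rank sequence is a family $\mathbf{r}=(r_v)_{v\in\mathscr{T}\setminus\{\rho\}}$ of positive integers; $r_\rho:=1$. It is admissible if $r_\lambda\le d_\lambda$ for $\lambda\in\mathscr{L}$ and $r_v\le\prod_{u\in\mathrm{ch}(v)}r_u$ for $v\in\mathscr{N}\setminus\{\rho\}$. Tree tensor network variety: $\mathrm{TTN}_{\mathscr{T},\mathbf{V},\mathbf{r}}\subset\mathbb{P}(W)$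 is the set of $[\psi]$ such that for each vertex $v\in\mathscr{T}$ there is a linear subspace $U_v$ with $\dim U_v\le r_v$ satisfying: $U_\lambda\subseteq V_\lambda$ for $\lambda\in\mathscr{L}$; $U_v\subseteq\bigotimes_{u\in\mathrm{ch}(v)}U_u$ for $v\in\mathscr{N}$; and some representative $\psi$ of $[\psi]$ lies in $U_\rho$. Spaced trees: a spaced tree $T$ is a finite undirected tree with a complex vector space $V_v$ of finite dimension $n_v$ at each vertex $v$, with a fixed non-degenerate symmetric bilinear form and an orthonormal basis. Its leaves $\mathcal{L}(T)$ are the vertices of degree one, the others are internal; $\mathcal{E}(T)$ is the edge set. A representation $A\in\mathrm{Rep}(T)=\prod_{\{v,w\}\in\mathcal{E}(T)}(V_v\otimes V_w)$ assigns to each edge $\{u,w\}$ a matrix $A_{uw}$ with entries $(A_{uw})_{j_uj_w}$, $1\le j_u\le n_u$, $1\le j_w\le n_w$ (with $A_{wu}=A_{uw}^{T}$). The contraction map $\Psi_T:\mathrm{Rep}(T)\to K_T:=\bigotimes_{v\in\mathcal{L}(T)}V_v$ is, in coordinates, $$(\Psi_T(A))_{(j_v)_{v\in\mathcal{L}(T)}}=\sum_{(j_v)_{v\notin\mathcal{L}(T)}}\ \prod_{\{u,w\}\in\mathcal{E}(T)}(A_{uw})_{j_uj_w},$$ the sum running over all $1\le j_v\le n_v$ for internal $v$. The general Markov model on $T$ is $\mathcal{V}_T=\mathbb{P}(\widehat{\mathcal{V}}_T)$, where $\widehat{\mathcal{V}}_T=\overline{\mathrm{im}(\Psi_T)}\subseteq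 K_T$ (Zariski closure). The spaced tree of $(\mathscr{T},\mathbf{V},\mathbf{r})$: $T$ is obtained from (the underlying undirected tree of) $\mathscr{T}$ by inserting a new vertex of degree two, called a rank node, on each edge; the rank node on the edge joining $u$ to its parent is denoted $h_u$. To $h_u$ attach a space of dimension $r_u$; to each $v\in\mathscr{N}$ attach a space of dimension $n_v:=\big(\prod_{u\in\mathrm{ch}(v)}r_u\big)r_v$; to each leaf $\lambda\in\mathscr{L}=\mathcal{L}(T)$ attach $V_\lambda=\mathbb{C}^{d_\lambda}$. All spaces carry the standard symmetric bilinear form and standard basis. Thus $K_T=W$. *)

(* Defs.v *)
From HB Require Import structures.
From mathcomp Require Import mpoly classical_sets reals complex.
From mathcomp Require Import all_boot all_order all_algebra.

Set Implicit Arguments.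
Unset Strict Implicit.
Unset Printing Implicit Defensive.

Import GRing.Theory.
Local Open Scope ring_scope.

(** * Tensors and projective spaces *)

(* The tensor product of the spaces K^(n i), i in I, in the standard bases. *)
Definition multi_index (I : finType) (n : I -> nat) : finType :=
  {dffun forall i : I, 'I_(n i)}.

Notation tensors K n := {ffun multi_index n -> K^o}.

(* P(V): a point is a line of V; the point [x] is the line <[x]>. *)
Definition proj (K : fieldType) (V : vectType K) :=
  {L : {vspace V} | \dim L == 1%N}.

(* P(X), the set of the [x] with x in X; x is nonzero since <[x]> is a line. *)
Definition proj_of (K : fieldType) (V : vectType K) (X : set V) :
  set (proj V) := [set p | exists2 x, X x & val p = <[x]>%VS]%classic.

Lemma proj_map_subproof (K : fieldType) (V W : vectType K) (f : 'Hom(V, W))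
  (injf : lker f == 0%VS) (p : proj V) : \dim (f @: val p)%VS == 1%N.
Proof. by rewrite limg_dim_eq ?(valP p) // (eqP injf) capv0. Qed.

Definition proj_map (K : fieldType) (V W : vectType K) (f : 'Hom(V, W))
  (injf : lker f == 0%VS) (p : proj V) : proj W :=
  exist _ (f @: val p)%VS (proj_map_subproof injf p).

Definition zariski_closure (K : fieldType) (I : finType)
  (S : set {ffun I -> K^o}) : set {ffun I -> K^o} :=
  [set x : {ffun I -> K^o} | forall p : {mpoly K[#|I|]},
     (forall y, S y -> p.@[fun i => y (enum_val i)] = 0) ->
     p.@[fun i => x (enum_val i)] = 0]%classic.

(** * Spaced trees and the general Markov model *)

(* Each space is K^(space_dim v), with its standard bilinear form and basis. *)
Record spaced_tree := SpacedTree {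
  st_vertex :> finType;
  adj : rel st_vertex;
  adj_sym : symmetric adj;
  adj_irr : irreflexive adj;
  adj_nonempty : (0 < #|st_vertex|)%N;
  adj_connected : forall x y, connect adj x y;
  adj_acyclic : forall c : seq st_vertex, ucycle adj c -> (size c <= 2)%N;
  space_dim : st_vertex -> nat }.

Definition degree (T : spaced_tree) (v : T) : nat := #|[set w | adj v w]|.

Definition st_leaf (T : spaced_tree) : finType :=
  {v : T | degree v == 1%N}.

Definition st_leaf_dim (T : spaced_tree) (l : st_leaf T) : nat :=
  space_dim (val l).

(* Each edge {u, w} occurs exactly once, as the pair (u, w) or (w, u); by
   rep_sym, the choice does not affect the matrix entries used below. *)
Definition edges (T : spaced_tree) : {set T * T} :=
  [set e | adj e.1 e.2 && (enum_rank e.1 < enum_rank e.2)%N].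

(* The condition rep_zero makes this the product over the edges only. *)
Record rep (K : fieldType) (T : spaced_tree) := Rep {
  rep_mx :> forall u w : T, 'M[K]_(space_dim u, space_dim w);
  rep_sym : forall u w, rep_mx w u = (rep_mx u w)^T;
  rep_zero : forall u w, ~~ adj u w -> rep_mx u w = 0 }.

Definition contraction (K : fieldType) (T : spaced_tree) (A : rep K T) :
  tensors K (@st_leaf_dim T) :=
  [ffun x : multi_index (@st_leaf_dim T) =>
    \sum_(j : multi_index (@space_dim T)
            | [forall l : st_leaf T, j (val l) == x l])
      \prod_(e in edges T) A e.1 e.2 (j e.1) (j e.2)].

Definition markov_model (K : fieldType) (T : spaced_tree) :
  set (proj (tensors K (@st_leaf_dim T))) :=
  proj_of (zariski_closure (range (@contraction K T))).

Arguments markov_model : clear implicits.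

(** * Rooted trees and tree tensor networks *)

(* The value parent rt_root = rt_root is a convention: the root has no parent. *)
Record rooted_tree := RootedTree {
  rt_vertex :> finType;
  rt_root : rt_vertex;
  parent : rt_vertex -> rt_vertex;
  parent_root : parent rt_root = rt_root;
  parent_connect : forall v, fconnect parent v rt_root }.
Arguments rt_root {r} : rename.

Definition children (T : rooted_tree) (v : T) : {set T} :=
  [set u | (u != rt_root) && (parent u == v)].

Definition is_leaf (T : rooted_tree) (v : T) : bool := children v == set0.

Definition leaf (T : rooted_tree) : finType := {v : T | is_leaf v}.
Definition inner (T : rooted_tree) : finType := {v : T | ~~ is_leaf v}.
Definition nonroot (T : rooted_tree) : finType := {v : T | v != rt_root}.
Definition child (T : rooted_tree) (v : T) : finType :=
  {u : T | u \in children v}.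

(* u is v or a descendant of v *)
Definition below (T : rooted_tree) (v u : T) : bool := fconnect (@parent T) u v.

Definition leaf_below (T : rooted_tree) (v : T) : finType :=
  {l : leaf T | below v (val l)}.

Record rank_seq (T : rooted_tree) := RankSeq {
  rank_val :> T -> nat;
  rank_pos : forall v, (0 < rank_val v)%N;
  rank_root : rank_val rt_root = 1%N }.

Definition admissible (T : rooted_tree) (d : leaf T -> nat)
  (r : rank_seq T) : Prop :=
  (forall l : leaf T, (r (val l) <= d l)%N) /\
  (forall v : T, ~~ is_leaf v -> v != rt_root ->
     (r v <= \prod_(u in children v) r u)%N).

Definition below_dim (T : rooted_tree) (d : leaf T -> nat) (v : T)
  (l : leaf_below v) : nat := d (val l).

(* The tensor product of the V_l over the leaves l below v. It contains all
   possible U_v, and it is V_v if v is a leaf. *)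
Notation subtree_tensors K d v := (tensors K (@below_dim _ d v)).

Lemma below_child (T : rooted_tree) (v : T) (u : child v) (w : T) :
  below (val u) w -> below v w.
Proof.
move=> uw; apply: connect_trans uw _; apply: connect1 => /=.
by have := valP u; rewrite inE => /andP[].
Qed.

Definition restrict_child (T : rooted_tree) (d : leaf T -> nat) (v : T)
  (u : child v) (j : multi_index (@below_dim T d v)) :
  multi_index (@below_dim T d (val u)) :=
  finfun (fun l : leaf_below (val u) =>
    j (exist _ (val l) (below_child (valP l)))).

Definition pure_tensor (K : fieldType) (T : rooted_tree) (d : leaf T -> nat)
  (v : T) (t : forall u : child v, subtree_tensors K d (val u)) :
  subtree_tensors K d v :=
  [ffun j : multi_index (@below_dim T d v) =>
    \prod_(u : child v) t u (restrict_child u j)].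

(* Membership in the tensor product of the subspaces U u, u child of v. *)
Definition in_tensor_product (K : fieldType) (T : rooted_tree)
  (d : leaf T -> nat) (v : T)
  (U : forall u : child v, {vspace subtree_tensors K d (val u)})
  (x : subtree_tensors K d v) : Prop :=
  exists (n : nat) (c : 'I_n -> K)
    (t : 'I_n -> forall u : child v, subtree_tensors K d (val u)),
    (forall i u, t i u \in U u) /\ x = \sum_i c i *: pure_tensor (t i).

(* All leaves are below the root, so that subtree_tensors K d rt_root is W. *)
Definition restrict_root (T : rooted_tree) (d : leaf T -> nat)
  (j : multi_index d) : multi_index (@below_dim T d rt_root) :=
  finfun (fun l : leaf_below rt_root => j (val l)).

Definition of_root (K : fieldType) (T : rooted_tree) (d : leaf T -> nat)
  (t : subtree_tensors K d rt_root) : tensors K d :=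
  [ffun j : multi_index d => t (restrict_root j)].

Definition ttn (K : fieldType) (T : rooted_tree) (d : leaf T -> nat)
  (r : rank_seq T) : set (proj (tensors K d)) :=
  [set p | exists U : forall v : T, {vspace subtree_tensors K d v},
    [/\ forall v, (\dim (U v) <= r v)%N,
        forall v, ~~ is_leaf v -> forall x, x \in U v ->
          in_tensor_product (fun u : child v => U (val u)) x
      & exists2 psi, psi \in U rt_root & val p = <[of_root psi]>%VS]]%classic.

Arguments ttn K {T} d r.

(** * The spaced tree associated with a rooted tree *)

(* Rank h is the rank node on the edge from h to its parent. Leaves and inner
   nodes are separated so that the dimension at Leaf l is d l by conversion. *)
Inductive svertex (T : rooted_tree) :=
  Leaf of leaf T | Inner of inner T | Rank of nonroot T.
Arguments Leaf {T}. Arguments Inner {T}. Arguments Rank {T}.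

Definition svertex_to (T : rooted_tree) (x : svertex T) :
  leaf T + inner T + nonroot T :=
  match x with
  | Leaf l => inl (inl l) | Inner v => inl (inr v) | Rank h => inr h end.
Definition svertex_from (T : rooted_tree) (x : leaf T + inner T + nonroot T) :
  svertex T :=
  match x with
  | inl (inl l) => Leaf l | inl (inr v) => Inner v | inr h => Rank h end.
Lemma svertexK (T : rooted_tree) : cancel (@svertex_to T) (@svertex_from T).
Proof. by case. Qed.
HB.instance Definition _ (T : rooted_tree) :=
  Finite.copy (svertex T) (can_type (@svertexK T)).

Definition tree_vertex (T : rooted_tree) (x : svertex T) : option T :=
  match x with
  | Leaf l => Some (val l) | Inner v => Some (val v) | Rank _ => None end.

Definition on_edge (T : rooted_tree) (x y : svertex T) : bool :=
  if x is Rank h then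
    (tree_vertex y == Some (val h)) || (tree_vertex y == Some (parent (val h)))
  else false.

Definition sadj (T : rooted_tree) (x y : svertex T) : bool :=
  on_edge x y || on_edge y x.

Definition sdim (T : rooted_tree) (d : leaf T -> nat) (r : rank_seq T)
  (x : svertex T) : nat :=
  match x with
  | Leaf l => d l
  | Inner v => ((\prod_(u in children (val v)) r u) * r (val v))%N
  | Rank h => r (val h)
  end.

Lemma sadj_sym (T : rooted_tree) : symmetric (@sadj T).
Proof. by move=> x y; rewrite /sadj orbC. Qed.

Lemma sadj_irr (T : rooted_tree) : irreflexive (@sadj T).
Proof. by case=> x; rewrite /sadj //=. Qed.

Definition to_svertex (T : rooted_tree) (v : T) : svertex T :=
  match boolP (is_leaf v) with
  | AltTrue h => Leaf (exist _ v h)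
  | AltFalse h => Inner (exist _ v h)
  end.

Lemma to_svertexK (T : rooted_tree) (v : T) :
  tree_vertex (to_svertex v) = Some v.
Proof. by rewrite /to_svertex; case: {-}_ / boolP. Qed.

Lemma tree_vertexE (T : rooted_tree) (x : svertex T) (v : T) :
  tree_vertex x = Some v -> x = to_svertex v.
Proof.
rewrite /to_svertex; case: {-}_ / boolP => hv; case: x => //= -[w hw] /= [e].
- by congr Leaf; apply: val_inj.
- by case/negP: hw; rewrite e.
- by case/negP: hv; rewrite -e.
- by congr Inner; apply: val_inj.
Qed.

Lemma svertex_nonempty (T : rooted_tree) : (0 < #|{: svertex T}|)%N.
Proof. by apply/card_gt0P; exists (to_svertex rt_root). Qed.

Definition depth (T : rooted_tree) (v : T) : nat :=
  findex (@parent T) v rt_root.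

Lemma depthP (T : rooted_tree) (v : T) : iter (depth v) (@parent T) v = rt_root.
Proof. exact/iter_findex/parent_connect. Qed.

Lemma depth_le (T : rooted_tree) (v : T) n :
  iter n (@parent T) v = rt_root -> (depth v <= n)%N.
Proof.
move=> e; rewrite leqNgt; apply/negP => lt.
have lto : (depth v < order (@parent T) v)%N.
  exact/findex_max/parent_connect.
have := findex_iter (ltn_trans lt lto); rewrite e -/(depth v) => e'.
by rewrite e' ltnn in lt.
Qed.

Lemma depth_parent (T : rooted_tree) (v : T) :
  v != rt_root -> depth v = (depth (parent v)).+1.
Proof.
move=> nr; have nd : (0 < depth v)%N.
  rewrite lt0n; apply: contra nr => /eqP d0.
  by have := depthP v; rewrite d0 /= => ->.
apply/eqP; rewrite eqn_leq; apply/andP; split.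
  by apply: depth_le; rewrite iterSr depthP.
rewrite -(prednK nd) ltnS; apply: depth_le.
by rewrite -iterSr prednK // depthP.
Qed.

Lemma parent_neq (T : rooted_tree) (v : T) : v != rt_root -> parent v != v.
Proof.
move=> /depth_parent e; apply/eqP => ev; rewrite ev in e.
by elim: (depth v) e => // n IH [].
Qed.

Lemma sadj_connected (T : rooted_tree) (x y : svertex T) :
  connect (@sadj T) x y.
Proof.
have csym := sym_connect_sym (@sadj_sym T).
have toP (h : nonroot T) v : (v == val h) || (v == parent (val h)) ->
    connect (@sadj T) (Rank h) (to_svertex v).
  move=> vh; apply: connect1; rewrite /sadj /= to_svertexK.
  by case/orP: vh => /eqP ->; rewrite eqxx ?orbT.
have vroot v : connect (@sadj T) (to_svertex v) (to_svertex rt_root).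
  have [n] := ubnP (depth v); elim: n v => // n IH v lt.
  have [->//|nr] := eqVneq v rt_root.
  pose h : nonroot T := exist _ v nr.
  apply: (connect_trans (y := Rank h)); first by rewrite csym toP //= eqxx.
  apply: (connect_trans (y := to_svertex (parent v))).
    by rewrite toP //= eqxx orbT.
  by apply: IH; rewrite (depth_parent nr) ltnS in lt.
have xroot z : connect (@sadj T) z (to_svertex rt_root).
  case ez: (tree_vertex z) => [v|]; first by rewrite (tree_vertexE ez).
  case: z ez => // h _; apply: connect_trans (vroot (val h)).
  by rewrite toP ?eqxx.
by apply: connect_trans (xroot x) _; rewrite csym.
Qed.

Definition sdepth (T : rooted_tree) (x : svertex T) : nat :=
  match x with
  | Leaf l => (depth (val l)).*2
  | Inner v => (depth (val v)).*2
  | Rank h => (depth (val h)).*2.-1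
  end.

Lemma sadj_up_uniq (T : rooted_tree) (x y z : svertex T) :
  sadj x y -> sadj x z -> (sdepth y <= sdepth x)%N ->
  (sdepth z <= sdepth x)%N -> y = z.
Proof.
have tvd (t : svertex T) (w : T) : tree_vertex t = Some w -> sdepth t = (depth w).*2.
  by case: t => [l|u|h] //= [->].
have dh (h : nonroot T) : depth (val h) = (depth (parent (val h))).+1.
  exact/depth_parent/(valP h).
have upR (h : nonroot T) (t : svertex T) : sadj (Rank h) t -> (sdepth t <= sdepth (Rank h))%N ->
    tree_vertex t = Some (parent (val h)).
  rewrite /sadj; case/orP=> [|]; last by case: t.
  case/orP=> /eqP // et; rewrite (tvd _ _ et) /= dh doubleS /=.
  by rewrite ltnn.
have upV (w : svertex T) (u : T) (t : svertex T) : tree_vertex w = Some u -> sadj w t ->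
    (sdepth t <= sdepth w)%N -> exists2 h : nonroot T, val h = u & t = Rank h.
  move=> ew; rewrite (tvd _ _ ew) /sadj.
  have -> : on_edge w t = false by case: w ew.
  case: t => // h /=; rewrite ew => /orP[] /eqP[e]; first by exists h.
  by rewrite dh e doubleS /= ltnn.
case ex: (tree_vertex x) => [u|].
  move=> ay az /(upV _ _ _ ex ay)[h eh ->] /(upV _ _ _ ex az)[k ek ->].
  by congr Rank; apply: val_inj; rewrite eh ek.
case: x ex => // h _ ay az /(upR _ _ ay) ey /(upR _ _ az) ez.
by rewrite (tree_vertexE ey) (tree_vertexE ez).
Qed.

Lemma sadj_acyclic (T : rooted_tree) (c : seq (svertex T)) :
  ucycle (@sadj T) c -> (size c <= 2)%N.
Proof.
move=> uc; rewrite leqNgt; apply/negP => gt2.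
have [x0 x0c] : exists x0, x0 \in c.
  by case: c gt2 {uc} => // a c _; exists a; rewrite inE eqxx.
case: (@arg_maxnP _ x0 (mem c) (@sdepth T) x0c) => x xc maxx.
have [i s es] := rot_to xc.
move: uc; rewrite -(rot_ucycle i) es.
have ms t : t \in s -> (sdepth t <= sdepth x)%N.
  by move=> ts; apply: maxx; rewrite /= -(mem_rot i) es inE ts orbT.
have : (2 < size (rot i c))%N by rewrite size_rot.
rewrite es; case: s ms {es} => [|y [|z s]] // ms _.
rewrite /ucycle /= rcons_path => /andP[/and3P[xy _ /andP[_ lx]]].
case/and3P=> _ ynot _.
suff e : y = last z s by rewrite e mem_last in ynot.
apply: (@sadj_up_uniq _ x) => //; first by rewrite sadj_sym.
  by apply: ms; rewrite inE eqxx.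
by apply: ms; rewrite inE mem_last orbT.
Qed.

Definition mk_nonroot (T : rooted_tree) (v : T) (nr : v != rt_root) : nonroot T :=
  exist _ v nr.

Definition associated_tree (T : rooted_tree) (d : leaf T -> nat)
  (r : rank_seq T) : spaced_tree :=
  SpacedTree (@sadj_sym T) (@sadj_irr T) (svertex_nonempty T)
    (@sadj_connected T) (@sadj_acyclic T) (sdim d r).

(** * The identification of K_T with W *)

Lemma degree_Leaf (T : rooted_tree) (d : leaf T -> nat) (r : rank_seq T)
  (hroot : (2 <= #|children (@rt_root T)|)%N) (l : leaf T) :
  @degree (associated_tree d r) (Leaf l) == 1%N.
Proof.
have nr : val l != rt_root.
  apply/eqP => e; have := valP l; rewrite /is_leaf e => /eqP e0.
  by rewrite e0 cards0 in hroot.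
apply/eqP; rewrite /degree -[RHS](cards1 (Rank (mk_nonroot nr) : svertex T)).
apply: eq_card => w; rewrite !inE /= /sadj /=.
apply/idP/eqP => [|->]; last by rewrite /= eqxx.
case: w => // h /= /orP[] /eqP[e]; first by congr Rank; apply: val_inj.
have : val h \in children (val l) by rewrite inE -e eqxx (valP h).
by rewrite (eqP (valP l)) inE.
Qed.

Lemma degree_Inner (T : rooted_tree) (d : leaf T -> nat) (r : rank_seq T)
  (hroot : (2 <= #|children (@rt_root T)|)%N) (v : inner T) :
  (2 <= @degree (associated_tree d r) (Inner v))%N.
Proof.
have rk u (hu : u \in children (val v)) :
    exists2 h : nonroot T, val h = u & sadj (Inner v) (Rank h).
  have := hu; rewrite inE => /andP[nu /eqP pu]; exists (mk_nonroot nu) => //.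
  by rewrite /sadj /= pu eqxx orbT.
rewrite /degree; apply/card_gt1P.
have [e|nr] := eqVneq (val v) rt_root.
  move: hroot; rewrite -e => /card_gt1P[a [b [ha hb ab]]].
  have [h eh sh] := rk a ha; have [k ek sk] := rk b hb.
  exists (Rank h), (Rank k); rewrite !inE; split=> //.
  by apply: contra ab => /eqP[e']; rewrite -eh -ek e'.
have /set0Pn[a ha] := valP v; have [h eh sh] := rk a ha.
exists (Rank h), (Rank (mk_nonroot nr)); rewrite !inE; split=> //.
  by rewrite /= /sadj /= eqxx.
apply/eqP => -[e]; move: (ha); rewrite -eh e inE => /andP[_].
by rewrite (negPf (parent_neq nr)).
Qed.

Lemma degree_Rank (T : rooted_tree) (d : leaf T -> nat) (r : rank_seq T)
  (h : nonroot T) : @degree (associated_tree d r) (Rank h) = 2%N.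
Proof.
have ne : to_svertex (val h) != to_svertex (parent (val h)).
  apply/eqP => /(congr1 (@tree_vertex T)); rewrite !to_svertexK => -[e].
  by have := parent_neq (valP h); rewrite -e eqxx.
rewrite /degree; set A := [set _ | _].
have -> : A = [set to_svertex (val h); to_svertex (parent (val h))].
  apply/setP => w; rewrite !inE /= /sadj /=.
  have -> : on_edge w (Rank h) = false by case: w.
  rewrite orbF; apply/orP/orP => -[/eqP e|/eqP e].
  - by left; rewrite (tree_vertexE e).
  - by right; rewrite (tree_vertexE e).
  - by left; rewrite e to_svertexK.
  - by right; rewrite e to_svertexK.
by rewrite cards2 ne.
Qed.

Definition leaf_in (T : rooted_tree) (d : leaf T -> nat) (r : rank_seq T)
  (hroot : (2 <= #|children (@rt_root T)|)%N) (l : leaf T) :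
  st_leaf (associated_tree d r) :=
  exist _ (Leaf l : associated_tree d r) (degree_Leaf d r hroot l).

Lemma leaf_in_onto (T : rooted_tree) (d : leaf T -> nat) (r : rank_seq T)
  (hroot : (2 <= #|children (@rt_root T)|)%N)
  (l' : st_leaf (associated_tree d r)) : {l | l' = leaf_in d r hroot l}.
Proof.
case: l' => [[l|v|h] hl].
- by exists l; apply: val_inj.
- by have := degree_Inner d r hroot v; rewrite (eqP hl).
- by have := hl; rewrite degree_Rank.
Qed.

Definition leaf_index (T : rooted_tree) (d : leaf T -> nat) (r : rank_seq T)
  (hroot : (2 <= #|children (@rt_root T)|)%N)
  (x : multi_index (@st_leaf_dim (associated_tree d r))) : multi_index d :=
  finfun (fun l : leaf T => x (leaf_in d r hroot l) : 'I_(d l)).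

Lemma leaf_index_bij (T : rooted_tree) (d : leaf T -> nat) (r : rank_seq T)
  (hroot : (2 <= #|children (@rt_root T)|)%N) :
  bijective (@leaf_index T d r hroot).
Proof.
pose g (y : multi_index d) (l' : st_leaf (associated_tree d r)) :
    'I_(st_leaf_dim l') :=
  let: exist l e := leaf_in_onto hroot l' in
  ecast z 'I_(st_leaf_dim z) (esym e)
    (y l : 'I_(st_leaf_dim (leaf_in d r hroot l))).
exists (fun y => finfun (g y)).
  move=> x; apply/ffunP => l'; rewrite ffunE /g.
  by case: (leaf_in_onto _ _) => l e; subst l'; rewrite /= ffunE.
move=> y; apply/ffunP => l; rewrite !ffunE /g.
case: (leaf_in_onto _ _) => k e.
have ek : l = k by move: (congr1 val e) => /= -[].
by subst k; rewrite (eq_irrelevance e erefl).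
Qed.

(* The isomorphism W -> K_T that relabels the leaves. *)
Definition leaf_iso_fun (K : fieldType) (T : rooted_tree) (d : leaf T -> nat)
  (r : rank_seq T) (hroot : (2 <= #|children (@rt_root T)|)%N)
  (t : tensors K d) : tensors K (@st_leaf_dim (associated_tree d r)) :=
  [ffun x => t (leaf_index hroot x)].

Lemma leaf_iso_linear (K : fieldType) (T : rooted_tree) (d : leaf T -> nat)
  (r : rank_seq T) (hroot : (2 <= #|children (@rt_root T)|)%N) :
  linear (@leaf_iso_fun K T d r hroot).
Proof. by move=> a s t; apply/ffunP => x; rewrite !ffunE. Qed.

HB.instance Definition _ (K : fieldType) (T : rooted_tree)
  (d : leaf T -> nat) (r : rank_seq T)
  (hroot : (2 <= #|children (@rt_root T)|)%N) :=
  GRing.isLinear.Build K (tensors K d)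
    (tensors K (@st_leaf_dim (associated_tree d r))) *:%R
    (@leaf_iso_fun K T d r hroot) (@leaf_iso_linear K T d r hroot).

Definition leaf_iso (K : fieldType) (T : rooted_tree) (d : leaf T -> nat)
  (r : rank_seq T) (hroot : (2 <= #|children (@rt_root T)|)%N) :
  'Hom(tensors K d, tensors K (@st_leaf_dim (associated_tree d r))) :=
  linfun (@leaf_iso_fun K T d r hroot).

Lemma leaf_iso_inj (K : fieldType) (T : rooted_tree) (d : leaf T -> nat)
  (r : rank_seq T) (hroot : (2 <= #|children (@rt_root T)|)%N) :
  lker (leaf_iso K d r hroot) == 0%VS.
Proof.
have [g fK gK] := leaf_index_bij d r hroot.
apply/lker0P => s t; rewrite !lfunE /= => /ffunP e; apply/ffunP => y.
by have := e (g y); rewrite !ffunE gK.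
Qed.

Lemma leaf_iso_surj (K : fieldType) (T : rooted_tree) (d : leaf T -> nat)
  (r : rank_seq T) (hroot : (2 <= #|children (@rt_root T)|)%N) :
  limg (leaf_iso K d r hroot) = fullv.
Proof.
have [g fK gK] := leaf_index_bij d r hroot.
apply/eqP; rewrite eqEsubv subvf /=; apply/subvP => s _.
apply/memv_imgP; exists [ffun y => s (g y)]; first exact: memvf.
by rewrite lfunE /=; apply/ffunP => x; rewrite !ffunE fK.
Qed.

Definition proj_leaf_iso (K : fieldType) (T : rooted_tree)
  (d : leaf T -> nat) (r : rank_seq T)
  (hroot : (2 <= #|children (@rt_root T)|)%N) :
  proj (tensors K d) ->
  proj (tensors K (@st_leaf_dim (associated_tree d r))) :=
  proj_map (leaf_iso_inj K d r hroot).
Arguments proj_leaf_iso K {T d r} hroot.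

(* Main.v *)
From HB Require Import structures.
Require Import Defs.
From mathcomp Require Import mpoly classical_sets reals complex.
From mathcomp Require Import all_boot all_order all_algebra.

(** Both sides are the projectivization of the cone of tensors whose flattening
    along every edge (leaves below v against the other leaves) has rank at most
    r v.  Cutting the contraction at the rank node of v writes a tensor of the
    general Markov model as a sum of r v products, so its minors of size larger
    than r v vanish, and these polynomials still vanish on the Zariski closure.
    If these minors vanish, the images of the flattenings are nested subspaces
    as in the definition of the tree tensor network variety.  Finally, choosing
    spanning families of size r v of nested subspaces U_v, the coefficient
    tensors at the inner vertices are encoded in the edge matrices of a
    representation, because the space at an inner vertex is large enough to
    index all their entries; so tree tensor networks already lie in the image
    of the contraction, without taking the closure. *)

Set Implicit Arguments.
Unset Strict Implicit.
Unset Printing Implicit Defensive.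

Import GRing.Theory.
Local Open Scope ring_scope.

(** * Leaf indices and flattenings *)

Section Indices.
Variables (T : rooted_tree) (d : leaf T -> nat).
Implicit Types (v w : T) (x y : multi_index d).

Lemma below_step v w : w != v -> below v w = below v (parent w).
Proof. by rewrite /below fconnect_eqVf; case: eqVneq. Qed.

Lemma below_depth v w : below v w -> (depth v <= depth w)%N.
Proof.
case/connectP=> p + ->; elim: p w => //= a p IH w /andP[/eqP ew pth].
apply: leq_trans (IH _ pth) _; rewrite -ew.
have [->|nr] := eqVneq w rt_root; first by rewrite parent_root.
by rewrite (depth_parent nr).
Qed.

Lemma childP v (u : child v) : val u != rt_root /\ parent (val u) = v.
Proof. by have := valP u; rewrite inE => /andP[-> /eqP]. Qed.

Lemma leaf_no_child v : is_leaf v -> child v -> False.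
Proof. by move=> /eqP lf [u]; rewrite lf inE. Qed.

(** Both vertices lie on the parent path starting at [t]; the induction follows it until it meets
    [w] or ends at [v]. *)
Lemma below_comparable v w t : below v t -> below w t -> below v w \/ below w v.
Proof.
case/connectP=> p + ->; elim: p t => [|a p IH] t /=; first by right.
case/andP=> /eqP et pth.
have [<- _|ne] := eqVneq t w.
  by left; apply/connectP; exists (a :: p); rewrite //= et eqxx.
by rewrite (below_step ne) et; apply: IH.
Qed.

(** Two siblings above [t] are comparable; were they distinct, one would lie above [v], against
    depth. *)
Lemma child_below_uniq v (u w : child v) t :
  below (val u) t -> below (val w) t -> u = w.
Proof.
have key (a b : child v) : below (val a) (val b) -> a = b.
  have [nb pb] := childP b; have [na pa] := childP a.
  have [e|ne] := eqVneq (val b) (val a); first by move=> _; apply: val_inj.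
  rewrite (below_step ne) pb => /below_depth.
  by rewrite (depth_parent na) pa ltnn.
by move=> ut wt; case: (below_comparable ut wt) => /key.
Qed.

Lemma below_childP v t : below v t -> t != v ->
  exists u : child v, below (val u) t.
Proof.
case/connectP=> p + ->; elim: p t => [|a p IH] t /=; first by rewrite eqxx.
case/andP=> /eqP et pth ne.
have [e|ne'] := eqVneq a (last a p).
  have nr : t != rt_root.
    by apply: contra ne => /eqP e'; rewrite -e -et e' parent_root.
  have ct : t \in children (last a p) by rewrite inE nr et -e eqxx.
  by exists (exist _ t ct) => /=; apply: connect0.
have [u hu] := IH _ pth ne'; exists u.
by apply: connect_trans hu; rewrite -et; apply: fconnect1.
Qed.

Lemma leaf_below_child v (l : leaf_below v) : ~~ is_leaf v ->
  exists u : child v, below (val u) (val (val l)).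
Proof.
move=> nl; apply: (below_childP (valP l)).
by apply: contra nl => /eqP <-; apply: (valP (val l)).
Qed.

Lemma index_irrelevance v (k : multi_index (@below_dim T d v)) (l : leaf_below v)
  (h : below v (val (val l))) : k (exist _ (val l) h) = k l.
Proof. by case: l h => l h0 h; rewrite /= (bool_irrelevance h h0). Qed.

Definition res v x : multi_index (@below_dim T d v) :=
  finfun (fun l : leaf_below v => x (val l)).

(* Matching on [boolP] makes the membership proof available without a cast. *)
Definition glue v (k : multi_index (@below_dim T d v)) x : multi_index d :=
  finfun (fun l : leaf T => match boolP (below v (val l)) with
  | AltTrue h => k (exist _ l h) | AltFalse _ => x l end).

(** [w (mix v x y)] is the entry in row [x] and column [y] of the flattening of [w] along the edge
    above [v]. Using full indices on both sides only repeats rows and columns. *)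
Definition mix v x y : multi_index d :=
  finfun (fun l : leaf T => if below v (val l) then x l else y l).

Definition replace_child v (u : child v)
  (k : multi_index (@below_dim T d (val u))) (i : multi_index (@below_dim T d v)) :
  multi_index (@below_dim T d v) :=
  finfun (fun l : leaf_below v => match boolP (below (val u) (val (val l))) with
  | AltTrue h => k (exist _ (val l) h) | AltFalse _ => i l end).

Lemma res_glue v k x : res v (glue k x) = k.
Proof.
apply/ffunP => l; rewrite !ffunE; case: {-}_ / boolP => h.
  exact: index_irrelevance.
by case/negP: h; apply: (valP l).
Qed.

Lemma glue_res v x y : glue (res v x) y = mix v x y.
Proof.
apply/ffunP => l; rewrite !ffunE; case: {-}_ / boolP => h.
  by rewrite h ffunE.
by rewrite (negPf h).
Qed.

Lemma restrict_res v (u : child v) x : restrict_child u (res v x) = res (val u) x.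
Proof. by apply/ffunP => l; rewrite !ffunE. Qed.

Lemma restrict_replace v (u : child v) k i :
  restrict_child u (replace_child k i) = k.
Proof.
apply/ffunP => l; rewrite !ffunE /=; case: {-}_ / boolP => h.
  exact: index_irrelevance.
by case/negP: h; apply: (valP l).
Qed.

Lemma restrict_replace_neq v (u w : child v) (k : multi_index (@below_dim T d (val u))) i :
  w != u -> restrict_child w (replace_child k i) = restrict_child w i.
Proof.
move=> ne; apply/ffunP => l; rewrite !ffunE /=; case: {-}_ / boolP => // h.
by case/eqP: ne; apply: child_below_uniq (valP l) h.
Qed.

Lemma replace_restrict v (u : child v) (i : multi_index (@below_dim T d v)) :
  replace_child (restrict_child u i) i = i.
Proof.
apply/ffunP => l; rewrite !ffunE /=; case: {-}_ / boolP => // h.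
by rewrite ffunE; apply: index_irrelevance.
Qed.

(** Each leaf below an inner vertex lies below one of its children; at a leaf the condition on
    children would be void. *)
Lemma restrict_inj v (i j : multi_index (@below_dim T d v)) : ~~ is_leaf v ->
  (forall u : child v, restrict_child u i = restrict_child u j) -> i = j.
Proof.
move=> nl e; apply/ffunP => l; have [u hu] := leaf_below_child l nl.
have := congr1 (fun f : multi_index _ => f (exist _ (val l) hu)) (e u).
by rewrite !ffunE /= !index_irrelevance.
Qed.

Lemma glue_replace v (u : child v) k i x :
  glue (replace_child k i) x = glue (v := val u) k (glue i x).
Proof.
apply/ffunP => l; rewrite ffunE [RHS]ffunE.
case: {-}_ / boolP => h1; case: {-}_ / boolP => h2; rewrite ?ffunE //=.
- case: {-}_ / boolP => h3; last by rewrite h2 in h3.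
  by rewrite (bool_irrelevance h3 h2).
- case: {-}_ / boolP => h3; first by case/negP: h2.
  case: {-}_ / boolP => h4; last by rewrite h1 in h4.
  by rewrite (bool_irrelevance h1 h4).
- by case/negP: h1; apply: below_child h2.
- by case: {-}_ / boolP => h3 //; case/negP: h1.
Qed.

End Indices.

(** * Minors of the flattenings *)

Section Minors.
Variables (K : fieldType) (T : rooted_tree) (d : leaf T -> nat).

(** The bound [r v] on the rank of the flattening along the edge above [v], in determinantal form:
    these are polynomial equations, hence they pass to the Zariski closure. *)
Definition minors_vanish (r : T -> nat) (w : tensors K d) :=
  forall v n (x y : 'I_n -> multi_index d), v != rt_root -> (r v < n)%N ->
  \det (\matrix_(a, b) w (mix v (x a) (y b))) = 0.

(** The matrix factors through a space of dimension [m < n], hence it is singular. *)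
Lemma det_sum_products (X Y : Type) (m n : nat) (f : 'I_m -> X -> K)
  (g : 'I_m -> Y -> K) (x : 'I_n -> X) (y : 'I_n -> Y) : (m < n)%N ->
  \det (\matrix_(a, b) \sum_(i < m) f i (x a) * g i (y b)) = 0.
Proof.
move=> mn; set M := \matrix_(a, b) _.
have eM : M = (\matrix_(a, i) f i (x a)) *m (\matrix_(i, b) g i (y b)).
  by apply/matrixP => a b; rewrite !mxE; apply: eq_bigr => i _; rewrite !mxE.
apply/eqP; rewrite -[_ == 0]negbK -unitfE -unitmxE -row_free_unit /row_free.
apply/negP=> /eqP rk; move: mn; rewrite -rk ltnNge => /negP; apply.
by rewrite eM; apply: leq_trans (mulmx_max_rank _ _) _.
Qed.

(* The hypothesis states that the 2 x 2 minors of the flattening of t vanish. *)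
Lemma rank_one_factor (v : T) (t : tensors K d) :
  (forall x y, t x * t y = t (mix v x y) * t (mix v y x)) ->
  exists f g : multi_index d -> K, forall x y, t (mix v x y) = f x * g y.
Proof.
have mixA x y z : mix v (mix v x y) z = mix v x z :> multi_index d.
  by apply/ffunP => l; rewrite !ffunE; case: below.
have mixB x y z : mix v x (mix v y z) = mix v x z :> multi_index d.
  by apply/ffunP => l; rewrite !ffunE; case: below.
move=> H; have [z nz|t0] := pickP (fun z => t z != 0).
  exists (fun x => t (mix v x z)), (fun y => t (mix v z y) / t z) => x y.
  apply: (mulIf nz); rewrite H mixA mixB mulrA divfK //.
by exists (fun _ => 0), (fun _ => 0) => x y; rewrite mul0r; apply/eqP/negPn; rewrite t0.
Qed.

End Minors.

(** * Minors vanish on the general Markov model *)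

Section Contraction.
Variables (K : fieldType) (T : rooted_tree) (d : leaf T -> nat) (r : rank_seq T).
Local Notation S := (associated_tree d r).
Local Notation sindex := (multi_index (@space_dim S)).

Definition compatible (j : sindex) (y : multi_index d) : bool :=
  [forall l : leaf T, j (Leaf l : S) == y l :> 'I_(d l)].

Definition edge_prod (A : rep K S) (j : sindex) : K :=
  \prod_(e in edges S) A e.1 e.2 (j e.1) (j e.2).

(** The contraction as an element of W, indexed by the leaves of the rooted tree instead of the
    vertices of degree one of [S]. *)
Definition leaf_contraction (A : rep K S) : tensors K d :=
  [ffun y => \sum_(j : sindex | compatible j y) edge_prod A j].

Lemma contractionE (hroot : (2 <= #|children (@rt_root T)|)%N) (A : rep K S) :
  contraction A = leaf_iso K d r hroot (leaf_contraction A).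
Proof.
rewrite lfunE /=; apply/ffunP => x; rewrite !ffunE; apply: eq_bigl => j.
apply/forallP/forallP => H l; last first.
  by have [k ->] := leaf_in_onto hroot l; have := H k; rewrite ffunE.
by rewrite ffunE; apply: (H (leaf_in d r hroot l)).
Qed.

(** * Cutting the spaced tree at a rank node *)

Section Cut.
Variable h : nonroot T.

(** [Rank h] itself counts as outside, so that every edge joining the two sides ends at [Rank h]. *)
Definition under_cut (s : S) : bool := match (s : svertex T) with
  | Leaf l => below (val h) (val l)
  | Inner v => below (val h) (val v)
  | Rank k => below (val h) (val k) && (k != h) end.

Definition swap_under (j j' : sindex) : sindex :=
  finfun (fun s => if under_cut s then j s else j' s).

Lemma swap_underK j j' : swap_under (swap_under j j') (swap_under j' j) = j.
Proof. by apply/ffunP => s; rewrite !ffunE; case: under_cut. Qed.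

Lemma under_cut_adj (s t : S) : adj s t ->
  [\/ s = Rank h, t = Rank h | under_cut s = under_cut t].
Proof.
have tv (x : svertex T) w : tree_vertex x = Some w -> under_cut x = below (val h) w.
  by case: x => [l|u|k] //= [->].
have key (x y : svertex T) : on_edge x y -> x = Rank h \/ under_cut x = under_cut y.
  case: x => //= k; have [-> _|ne] := eqVneq k h; first by left.
  by case/orP=> /eqP /tv ->; right; rewrite andbT // below_step.
case/orP=> /key[->|e]; first by constructor 1.
- by constructor 3.
- by constructor 2.
- by constructor 3.
Qed.

(** On an edge away from [Rank h] both ends are taken from the same index, so the two factors are
    kept or exchanged; at [Rank h] the two indices agree. *)
Lemma edge_prod_swap (A : rep K S) (j j' : sindex) :
  j (Rank h : S) = j' (Rank h : S) ->
  edge_prod A j * edge_prod A j' =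
  edge_prod A (swap_under j j') * edge_prod A (swap_under j' j).
Proof.
move=> eh; rewrite /edge_prod -!big_split; apply: eq_bigr => -[s t] /=.
rewrite inE /= => /andP[/under_cut_adj st _].
have Eh (b : bool) : (if b then j (Rank h : S) else j' (Rank h : S)) = j (Rank h : S).
  by case: b.
rewrite !ffunE; case: st => [->|->|->].
- by rewrite [under_cut (Rank h)]/= eqxx andbF -eh; case: under_cut => //; rewrite mulrC.
- by rewrite [under_cut (Rank h)]/= eqxx andbF -eh; case: under_cut => //; rewrite mulrC.
- by case: under_cut => //; rewrite mulrC.
Qed.

(** The summands with value [i] at [Rank h]; each such term has a flattening of rank at most one
    along the cut. *)
Definition cut_term (A : rep K S) (i : 'I_(r (val h))) : tensors K d :=
  [ffun y => \sum_(j : sindex | compatible j y && (j (Rank h : S) == i :> 'I_(r (val h))))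
     edge_prod A j].

Lemma sum_cut_term (A : rep K S) : leaf_contraction A = \sum_i cut_term A i.
Proof.
apply/ffunP => y; rewrite ffunE sum_ffunE.
rewrite (partition_big (fun j : sindex => j (Rank h : S) : 'I_(r (val h))) xpredT) //=.
by apply: eq_bigr => i _; rewrite ffunE.
Qed.

(* Exchanging the parts below the cut is an involution on the pairs of indices
   that agree at the rank node h, and it preserves the product of the weights. *)
Lemma cut_term_swap (A : rep K S) i (x y : multi_index d) :
  cut_term A i x * cut_term A i y =
  cut_term A i (mix (val h) x y) * cut_term A i (mix (val h) y x).
Proof.
rewrite !ffunE !big_distrlr /= !pair_big /=.
rewrite (reindex_inj (h := fun p : sindex * sindex => (swap_under p.1 p.2, swap_under p.2 p.1))) /=; last first.
  move=> [a b] [a' b'] [e1 e2]; congr (_, _).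
    by rewrite -(swap_underK a b) e1 e2 swap_underK.
  by rewrite -(swap_underK b a) e1 e2 swap_underK.
have compat a b (u v : multi_index d) : compatible a u -> compatible b v ->
    compatible (swap_under a b) (mix (val h) u v).
  move=> /forallP ca /forallP cb; apply/forallP => l; rewrite !ffunE /=.
  by case: below; rewrite ?(eqP (ca l)) ?(eqP (cb l)).
have mixK (u v : multi_index d) : mix (val h) (mix (val h) u v) (mix (val h) v u) = u.
  by apply/ffunP => l; rewrite !ffunE; case: below.
have rk a b : (swap_under a b) (Rank h : S) = b (Rank h : S).
  by rewrite ffunE /= eqxx andbF.
apply: eq_big => [[a b]|[a b]] /=; last first.
  by case/andP=> /andP[_ /eqP ea] /andP[_ /eqP eb]; move: ea eb; rewrite !rk => ea eb;
    rewrite [RHS]edge_prod_swap ?ea ?eb // swap_underK.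
rewrite !rk; apply/idP/idP => /andP[/andP[ca ra] /andP[cb rb]]; rewrite ra rb !andbT.
  by have := compat _ _ _ _ ca cb; rewrite swap_underK => ->;
     have := compat _ _ _ _ cb ca; rewrite swap_underK.
by have := compat _ _ _ _ ca cb; rewrite mixK => ->;
   have := compat _ _ _ _ cb ca; rewrite mixK.
Qed.
End Cut.

Lemma minors_contraction (A : rep K S) : minors_vanish r (leaf_contraction A).
Proof.
move=> v n x y nr lt; pose h := mk_nonroot nr.
(* Each of the [r v] terms of the cut is a product of a function below the cut and a function of the
   rest. *)
have [f fP] := fin_all_exists (fun i => rank_one_factor (cut_term_swap (h := h) A i)).
have [g gP] := fin_all_exists fP.
rewrite -[RHS](det_sum_products f g x y lt); congr (\det _).
apply/matrixP => a b; rewrite !mxE (sum_cut_term h) sum_ffunE.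
by apply: eq_bigr => i _; rewrite gP.
Qed.

Lemma minors_closure (hroot : (2 <= #|children (@rt_root T)|)%N) (w : tensors K d) :
  zariski_closure (range (@contraction K S)) (leaf_iso K d r hroot w) ->
  minors_vanish r w.
Proof.
have [g gK1 gK2] := leaf_index_bij d r hroot.
have isoE (t : tensors K d) m : leaf_iso K d r hroot t (g m) = t m.
  by rewrite lfunE /= ffunE gK2.
move=> cl v n x y nr lt.
(* The minor as a polynomial in the coordinates of K_T; [g] turns an index of W into one of K_T. *)
pose p : {mpoly K[#|multi_index (@st_leaf_dim S)|]} :=
  \det (\matrix_(a < n, b < n) 'X_(enum_rank (g (mix v (x a) (y b))))).
have pE (t : tensors K d) : p.@[fun i => leaf_iso K d r hroot t (enum_val i)] =
    \det (\matrix_(a, b) t (mix v (x a) (y b))).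
  rewrite /p -det_map_mx; congr (\det _); apply/matrixP => a b; rewrite !mxE /=.
  by rewrite mevalXU enum_rankK isoE.
have := cl p; rewrite pE; apply=> _ [A _ <-].
by rewrite (contractionE hroot) pE minors_contraction.
Qed.
End Contraction.

(** * Minimal subspaces *)

Section TensorProduct.
Variables (K : fieldType) (T : rooted_tree) (d : leaf T -> nat) (v : T).
Local Notation subtensors := (forall u : child v, subtree_tensors K d (val u)).
Local Notation subspaces := (forall u : child v, {vspace subtree_tensors K d (val u)}).
Implicit Types (U : subspaces) (t : subtensors) (x : subtree_tensors K d v).

Lemma tensor_product_sum U (I : finType) (c : I -> K) (x : I -> subtree_tensors K d v) :
  (forall i, in_tensor_product U (x i)) -> in_tensor_product U (\sum_i c i *: x i).
Proof.
move=> H; have [n nP] := fin_all_exists H; have [a aP] := fin_all_exists nP.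
have [t tP] := fin_all_exists aP.
pose J := {i : I & 'I_(n i)}.
exists #|{: J}|, (fun k => let j := enum_val k : J in c (tag j) * a (tag j) (tagged j)),
  (fun k => let j := enum_val k : J in t (tag j) (tagged j)).
split=> [k u|]; first by case: (tP (tag (enum_val k : J))).
rewrite -(big_enum_val (fun j : J => (c (tag j) * a (tag j) (tagged j)) *:
  pure_tensor (t (tag j) (tagged j)))) /=.
transitivity (\sum_(i : I) \sum_(k : 'I_(n i)) (c i * a i k) *: pure_tensor (t i k)).
  apply: eq_bigr => i _; case: (tP i) => _ ->.
  by rewrite scaler_sumr; apply: eq_bigr => k _; rewrite scalerA.
by rewrite (sig_big_dep xpredT (fun _ => xpredT)
  (fun i k => (c i * a i k) *: pure_tensor (t i k))).
Qed.

Lemma tensor_product_pure U t : (forall u, t u \in U u) -> in_tensor_product U (pure_tensor t).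
Proof.
move=> tU; exists 1%N, (fun _ => 1), (fun _ => t); split=> //.
by rewrite big_ord1 scale1r.
Qed.

Lemma tensor_product_span U (X : seq (subtree_tensors K d v)) x :
  (forall y, y \in X -> in_tensor_product U y) -> x \in <<X>>%VS -> in_tensor_product U x.
Proof.
move=> XU xX; rewrite (coord_span (X := in_tuple X) xX); apply: tensor_product_sum => i.
by apply: XU; apply: mem_nth.
Qed.

(** A slice in the direction of the factor [u]: the coordinates of the other factors are fixed to
    those of [i]. *)
Definition child_slice (u : child v) (i : multi_index (@below_dim T d v)) x :
  subtree_tensors K d (val u) := [ffun k => x (replace_child k i)].

Lemma child_slice_is_linear u i : linear (child_slice u i).
Proof. by move=> a x y; apply/ffunP => k; rewrite !ffunE. Qed.

HB.instance Definition _ u i := GRing.isLinear.Build K (subtree_tensors K d v)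
  (subtree_tensors K d (val u)) *:%R (child_slice u i) (@child_slice_is_linear u i).

(** The operator [f] on the factor [u], tensored with the identity on the other factors. *)
Definition apply_child (u : child v) (f : 'End(subtree_tensors K d (val u))) x :
  subtree_tensors K d v :=
  [ffun i => f (child_slice u i x) (restrict_child u i)].

Lemma apply_child_is_linear u f : linear (@apply_child u f).
Proof.
move=> a x y; apply/ffunP => k; rewrite [LHS]ffunE.
by rewrite (linearP (child_slice u k)) linearP !ffunE.
Qed.

HB.instance Definition _ u f := GRing.isLinear.Build K (subtree_tensors K d v)
  (subtree_tensors K d v) *:%R (@apply_child u f) (@apply_child_is_linear u f).

Lemma apply_child_id (u : child v) (f : 'End(subtree_tensors K d (val u))) x :
  (forall i, f (child_slice u i x) = child_slice u i x) -> apply_child f x = x.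
Proof. by move=> H; apply/ffunP => i; rewrite ffunE H ffunE replace_restrict. Qed.

Lemma apply_child_pure (f : forall u : child v, 'End(subtree_tensors K d (val u))) u t :
  apply_child (f u) (pure_tensor t) =
  pure_tensor (fun w => if w == u then f w (t w) else t w).
Proof.
apply/ffunP => i; rewrite !ffunE.
have -> : child_slice u i (pure_tensor t) =
    (\prod_(w | w != u) t w (restrict_child w i)) *: t u.
  apply/ffunP => k; rewrite !ffunE (bigD1 u) //= restrict_replace mulrC.
  by congr (_ * _); apply: eq_bigr => w wu; rewrite restrict_replace_neq.
rewrite linearZ ffunE [RHS](bigD1 u) //= eqxx mulrC; congr (_ * _).
by apply: eq_bigr => w /negPf ->.
Qed.

Definition tensor_delta (j : multi_index (@below_dim T d v)) : subtensors :=
  fun u => [ffun k => (k == restrict_child u j)%:R].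

Lemma tensor_delta_expansion x : ~~ is_leaf v ->
  x = \sum_j x j *: pure_tensor (tensor_delta j).
Proof.
move=> nl; apply/ffunP => i; rewrite sum_ffunE (bigD1 i) //= big1 ?addr0.
  rewrite !ffunE big1 => [|u _]; first by rewrite [RHS]mulr1.
  by rewrite !ffunE eqxx.
move=> j ne; rewrite !ffunE; have [u hu|all] := pickP (fun u => restrict_child u i != restrict_child u j).
  by rewrite (bigD1 u) //= ffunE (negPf hu) mul0r [LHS]mulr0.
case/eqP: ne; apply: (restrict_inj nl) => u.
by apply/eqP; rewrite eq_sym; have := all u => /negbFE.
Qed.

(** The condition is imposed one child at a time: [U' s] asks for [U u] when [u] is in [s] and for
    the whole space otherwise. The empty list is settled by the standard basis, the list of all
    children gives the claim. *)
Lemma in_tensor_product_of_slices U x : ~~ is_leaf v ->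
  (forall u i, child_slice u i x \in U u) -> in_tensor_product U x.
Proof.
move=> nl sl; pose U' (s : seq (child v)) u := if u \in s then U u else fullv.
suff H s : in_tensor_product (U' s) x.
  have [n [c [t [tU ->]]]] := H (enum {: child v}).
  exists n, c, t; split=> // i u; have := tU i u.
  by rewrite /U' mem_enum.
elim: s => [|u s IH].
  rewrite (tensor_delta_expansion x nl); apply: tensor_product_sum => j.
  by apply: tensor_product_pure => u; apply: memvf.
(* The projection of the factor u fixes x and maps pure tensors to pure ones. *)
pose f w := projv (U w).
rewrite -(@apply_child_id u (f u) x) => [|i]; last exact/projv_id/sl.
have [n [c [t [tU ->]]]] := IH; rewrite linear_sum /=.
under eq_bigr do rewrite linearZ /= apply_child_pure.
apply: tensor_product_sum => i; apply: tensor_product_pure => w.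
rewrite /U' inE; case: eqP => [_|_] /=; first exact: memv_proj.
exact: tU.
Qed.
End TensorProduct.

(** * Images of the flattenings as nested subspaces *)

Section FlatteningRanks.
Variables (K : fieldType) (T : rooted_tree) (d : leaf T -> nat) (w : tensors K d).

(** Column [x] of the flattening at [v], so that [min_subspace] is the column space. *)
Definition flat_slice (v : T) (x : multi_index d) : subtree_tensors K d v :=
  [ffun k => w (glue k x)].

Definition min_subspace (v : T) : {vspace subtree_tensors K d v} :=
  <<codom (flat_slice v)>>%VS.

Lemma child_flat_slice v (u : child v) i x :
  child_slice u i (flat_slice v x) = flat_slice (val u) (glue i x).
Proof. by apply/ffunP => k; rewrite !ffunE glue_replace. Qed.

(** A slice of a generator in the direction of a child is a [flat_slice] at that child, so the slice
    criterion applies to the generators. *)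
Lemma min_subspace_nested v x : ~~ is_leaf v -> x \in min_subspace v ->
  in_tensor_product (fun u : child v => min_subspace (val u)) x.
Proof.
move=> nl; apply: tensor_product_span => _ /codomP[y ->].
apply: in_tensor_product_of_slices => // u i.
by rewrite child_flat_slice; apply/memv_span/codom_f.
Qed.

Lemma dim_min_subspace (r : T -> nat) v : minors_vanish r w -> v != rt_root ->
  (\dim (min_subspace v) <= r v)%N.
Proof.
move=> mv nr; pose X := multi_index d; pose Y := multi_index (@below_dim T d v).
pose B : 'M[K]_(#|X|, #|Y|) := \matrix_(a, b) w (glue (enum_val b) (enum_val a)).
have rkB : (\rank B <= r v)%N.
  rewrite leqNgt; apply/negP => lt.
  (* Independent rows of maximal number, then independent columns among them, give an invertible
     minor of size [\rank B]. *)
  pose C := (rowsub (maxrankfun B) B)^T.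
  have fC : row_full C by rewrite /row_full mxrank_tr; apply: maxrowsub_free.
  have := fullrowsub_unit fC; rewrite unitmxE unitfE => /eqP; apply.
  pose gx a := enum_val (fullrankfun fC a) : Y; pose fy a := enum_val (maxrankfun B a) : X.
  (* [fy a] only completes [gx a] to a full index; [mix] discards those coordinates. *)
  rewrite -(mv v _ (fun a => glue (gx a) (fy a)) fy nr lt); congr (\det _).
  by apply/matrixP => a b; rewrite !mxE -glue_res res_glue.
(* The rows of [row_base B] span all slices, and there are [\rank B] of them. *)
apply: leq_trans rkB; pose rows := [seq ([ffun k => row_base B i (enum_rank k)] : subtree_tensors K d v) | i : 'I_(\rank B)].
have sz : size rows = \rank B by rewrite size_map -cardE card_ord.
rewrite -[X in (_ <= X)%N]sz; apply: leq_trans (dim_span rows); apply: dimvS.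
apply/span_subvP => _ /codomP[x ->].
have -> : flat_slice v x = \sum_(i < \rank B) col_base B (enum_rank x) i *:
    ([ffun k => row_base B i (enum_rank k)] : subtree_tensors K d v).
  apply/ffunP => k; rewrite sum_ffunE ffunE.
  have := congr1 (fun M : 'M_(_,_) => M (enum_rank x) (enum_rank k)) (mulmx_base B).
  rewrite !mxE !enum_rankK => <-; apply: eq_bigr => i _; rewrite !ffunE //.
apply: memv_suml => i _; apply: memvZ; apply: memv_span.
by apply: map_f; rewrite mem_enum.
Qed.

Lemma glue_root k (x : multi_index d) : glue (v := rt_root) (restrict_root k) x = k.
Proof.
apply/ffunP => l; rewrite ffunE; case: {-}_ / boolP => h; first by rewrite ffunE.
by case/negP: h; apply: parent_connect.
Qed.

Lemma glue_root_const k (x y : multi_index d) : glue (v := rt_root) k x = glue k y.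
Proof.
apply/ffunP => l; rewrite !ffunE; case: {-}_ / boolP => h //.
by case/negP: h; apply: parent_connect.
Qed.

Lemma ttn_of_minors (r : rank_seq T) (p : proj (tensors K d)) :
  (forall l, (0 < d l)%N) -> minors_vanish r w -> val p = <[w]>%VS -> ttn K d r p.
Proof.
move=> hd mv ep; exists min_subspace; split.
- move=> v; have [->|nr] := eqVneq v rt_root; last exact: dim_min_subspace.
  pose y0 : multi_index d := finfun (fun l => Ordinal (hd l)).
  (* All leaves lie below the root, so the root slices coincide and span at most a line, which
     matches [rank_root]. *)
  have : (min_subspace rt_root <= <[flat_slice rt_root y0]>)%VS.
    apply/span_subvP => _ /codomP[x ->]; rewrite (_ : flat_slice _ x = flat_slice rt_root y0) ?memv_line //.
    by apply/ffunP => k; rewrite !ffunE (glue_root_const _ _ y0).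
  by move/dimvS/leq_trans; apply; rewrite dim_vline rank_root leq_b1.
- by move=> v nl x; apply: min_subspace_nested.
- pose y0 : multi_index d := finfun (fun l => Ordinal (hd l)).
  exists (flat_slice rt_root y0); first exact/memv_span/codom_f.
  by rewrite ep; congr <[_]>%VS; apply/ffunP => k; rewrite !ffunE glue_root.
Qed.
End FlatteningRanks.

(** * Expansion of nested families along the tree *)

Lemma prod_sum_multi_index (K : comPzSemiRingType) (I : finType) (n : I -> nat)
  (F : forall i, 'I_(n i) -> K) :
  \prod_i \sum_(a < n i) F i a = \sum_(k : multi_index n) \prod_i F i (k i).
Proof.
rewrite (reindex (@dffun_of_fprod _ (fun i => 'I_(n i)))) /=; last first.
  exact/onW_bij/dffun_of_fprod_bij.
pose G i : {ffun 'I_(n i) -> K} := [ffun a => F i a].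
transitivity (\sum_(t : fprod (fun i : I => 'I_(n i))) \prod_(i in I) G i (t i)); last first.
  by apply: eq_bigr => t _; apply: eq_bigr => i _; rewrite !ffunE.
rewrite (big_fprod _ _ G) -(bigA_distr_big_dep _ (fun i p => untag 0 (G i) p)).
apply: eq_bigr => i _; rewrite -(big_tag (fun i => G i)).
by apply: eq_bigr => a _; rewrite ffunE.
Qed.

Lemma card_multi_index (I : finType) (n : I -> nat) :
  #|multi_index n| = (\prod_i n i)%N.
Proof.
rewrite (bij_eq_card (@fprod_of_dffun_bij I (fun i => 'I_(n i)))) card_fprod.
by apply: eq_bigr => i _; rewrite card_ord.
Qed.

Local Notation kid_index r v := (multi_index (fun u : child v => rank_val r (val u))).

Section TreeExpansion.
Variables (K : comPzSemiRingType) (T : rooted_tree) (r : rank_seq T).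
Local Notation assignment := (multi_index r).

Definition kids (v : T) (a : assignment) : kid_index r v :=
  finfun (fun u : child v => a (val u)).

Definition set_kids (v : T) (a : assignment) (k : kid_index r v) : assignment :=
  finfun (fun u : T => match boolP (u \in children v) with
  | AltTrue h => k (exist _ u h) | AltFalse _ => a u end).

Lemma kids_set_kids v a k : kids v (set_kids a k) = k.
Proof.
apply/ffunP => u; rewrite !ffunE; case: {-}_ / boolP => h; last by case/negP: h; apply: valP.
by case: u h => u h0 h; rewrite /= (bool_irrelevance h h0).
Qed.

Lemma set_kids_kids v a : set_kids a (kids v a) = a.
Proof.
by apply/ffunP => u; rewrite ffunE; case: {-}_ / boolP => h; rewrite ?ffunE.
Qed.

Lemma set_kidsK v a (k k' : kid_index r v) : set_kids (set_kids a k) k' = set_kids a k'.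
Proof.
apply/ffunP => u; rewrite !ffunE; case: {-}_ / boolP => h //.
Qed.

Lemma set_kids_out v a (k : kid_index r v) u : u \notin children v -> set_kids a k u = a u.
Proof. by move=> nu; rewrite ffunE; case: {-}_ / boolP => h //; case/negP: nu. Qed.

Lemma kids_set_kids_out v w a (k : kid_index r v) : w != v ->
  kids w (set_kids a k) = kids w a.
Proof.
move=> ne; apply/ffunP => u; rewrite !ffunE; case: {-}_ / boolP => h //.
have [_ pu] := childP u; case/eqP: ne; move: h.
by rewrite inE pu => /andP[_ /eqP].
Qed.

Variables (g : T -> nat -> K) (C : forall v : T, nat -> kid_index r v -> K).
Arguments C : clear implicits.
(** The recursion from a vertex to its children. At a leaf the sum has one term with an empty
    product, so there [C v i] is just [g v i]. *)
Hypothesis gE : forall v i, g v i = \sum_(k : kid_index r v) C v i k * \prod_(u : child v) g (val u) (k u).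

Definition reached (S : {set T}) (v : T) : bool := (v == rt_root) || (parent v \in S).

(* Here gE has been unfolded exactly at the vertices of S; indices that do not
   occur yet are pinned to 0, so that the sum ranges over a fixed type. *)
Definition partial_expansion (S : {set T}) : K :=
  \sum_(a : assignment | [forall v, reached S v || (a v == 0 :> nat)])
    ((\prod_(v in S) C v (a v) (kids v a)) *
     \prod_(v | (v \notin S) && reached S v) g v (a v)).

(** Every index except that of the root is pinned to 0, and the root index is 0 because [r] equals 1
    there. *)
Lemma partial_expansion0 : partial_expansion set0 = g rt_root 0.
Proof.
pose a0 : assignment := finfun (fun v => Ordinal (rank_pos r v)).
rewrite /partial_expansion (big_pred1 a0) => [|a].
  rewrite big_pred0 ?mul1r => [|v]; last by rewrite inE.
  by rewrite (big_pred1 rt_root) => [|v]; rewrite ?ffunE // !inE /reached !inE orbF.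
apply/forallP/eqP => [H|-> v]; last by rewrite ffunE eqxx orbT.
apply/ffunP => v; apply/val_inj; rewrite ffunE /=.
have := H v; rewrite /reached inE orbF; case: eqP => [-> _|_ /eqP//].
by have := ltn_ord (a rt_root); rewrite [X in (_ < X)%N]rank_root; case: (nat_of_ord _).
Qed.

(** The assignments for [w |: S] are grouped by what remains after resetting the children of [w] to
    0; each group sums to one term of the expansion for [S], with its factor [g w] unfolded by
    [gE]. *)
Lemma partial_expansion_step (S : {set T}) w : {in S, forall v, reached S v} ->
  w \notin S -> reached S w -> partial_expansion (w |: S) = partial_expansion S.
Proof.
move=> clS wS rw.
have kidS u : u \in children w -> [/\ ~~ reached S u, u \notin S & u != w].
  rewrite inE => /andP[nu /eqP pu]; rewrite /reached (negPf nu) pu wS; split=> //.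
    by apply: contra wS => /clS; rewrite /reached (negPf nu) pu.
  by apply/eqP => e; have := parent_neq nu; rewrite pu e eqxx.
have reachedU v : reached (w |: S) v = reached S v || (v \in children w).
  rewrite /reached !inE; case: (v == _) => //=; exact: orbC.
pose a0 : kid_index r w := finfun (fun u : child w => Ordinal (rank_pos r (val u))).
pose z a := set_kids a a0.
rewrite /partial_expansion.
rewrite (partition_big z (fun a => [forall v, reached S v || (a v == 0 :> nat)])); last first.
  move=> a /forallP H; apply/forallP => v; have := H v; rewrite reachedU.
  have [vw _|nvw] := boolP (v \in children w); last by rewrite orbF set_kids_out.
  by rewrite ffunE; case: {-}_ / boolP => h; [rewrite ffunE eqxx orbT | case/negP: h].
apply: eq_bigr => a /forallP Ha.
(* The group of [a] is parametrised by the indices at the children of [w]. *)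
rewrite (reindex_onto (set_kids a) (kids w)) => [|b /andP[_ /eqP <-]]; last first.
  by rewrite set_kidsK set_kids_kids.
rewrite [RHS]mulrC (bigD1 w) /=; last by rewrite wS.
rewrite gE -mulrA mulr_suml.
apply: eq_big => [k|k _].
  rewrite kids_set_kids eqxx andbT /z set_kidsK; apply/andP; split.
    apply/forallP => v; rewrite reachedU; have [//|vw] := boolP (v \in children w).
      by rewrite orbT.
    by rewrite orbF set_kids_out.
  apply/eqP/ffunP => v; have [vw|vw] := boolP (v \in children w); last by rewrite set_kids_out.
  rewrite ffunE; case: {-}_ / boolP => h; last by case/negP: h.
  rewrite ffunE; apply/val_inj => /=; apply/esym/eqP.
  by have := Ha v; have [/negPf -> _ _] := kidS _ vw.
rewrite (bigD1 w) ?inE ?eqxx //= kids_set_kids set_kids_out; last first.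
  by apply/negP => /kidS[_ _]; rewrite eqxx.
have -> : \prod_(v in w |: S | v != w) C v (set_kids a k v) (kids v (set_kids a k)) =
    \prod_(v in S) C v (a v) (kids v a).
  apply: eq_big => [v|v /andP[]]; rewrite !inE.
    by case: eqP => [->|] //=; rewrite ?andbT // (negPf wS).
  move=> vS vw; rewrite kids_set_kids_out // set_kids_out //; apply/negP => /kidS[_].
  by move: vS; rewrite (negPf vw) /= => ->.
have -> : \prod_(v | (v \notin w |: S) && reached (w |: S) v) g v (set_kids a k v) =
    (\prod_(u : child w) g (val u) (k u)) *
    \prod_(v | (v \notin S) && reached S v && (v != w)) g v (a v).
  rewrite (bigID (mem (children w))) /=; congr (_ * _).
    transitivity (\prod_(v in children w) g v (set_kids a k v)).
      apply: eq_bigl => v; rewrite reachedU [v \in w |: S]in_setU1 negb_or.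
      case vw: (v \in children w); rewrite ?andbF ?andbT ?orbT //.
      by have [_ -> ->] := kidS _ vw.
    rewrite (big_sub (children w)); apply: eq_bigr => u _.
    have <- : kids w (set_kids a k) u = k u :> nat by rewrite kids_set_kids.
    by rewrite [in RHS]ffunE.
  apply: eq_big => [v|v /andP[_ nv]]; last by rewrite set_kids_out.
  rewrite reachedU in_setU1 negb_or; case vw: (v \in children w); rewrite ?andbF ?orbF ?andbT.
    by have [/negPf -> _ _] := kidS _ vw; rewrite andbF.
  by case: (v == w); case: (v \in S); case: reached.
rewrite -!mulrA; congr (_ * _); rewrite mulrCA; congr (_ * _).
by rewrite mulrC.
Qed.

(** Vertices are expanded from the root downwards; once [S] is the whole tree, no factor [g] is
    left. *)
Lemma tree_expansion :
  g rt_root 0 = \sum_(a : assignment) \prod_v C v (a v) (kids v a).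
Proof.
suff H n : (n <= #|T|)%N -> exists S : {set T},
    [/\ #|S| = n, {in S, forall v, reached S v} & partial_expansion S = g rt_root 0].
  have [S [cS _ <-]] := H #|T| (leqnn _).
  have {cS}-> : S = setT by apply/eqP; rewrite eqEcard subsetT cardsT cS /=.
  rewrite /partial_expansion; apply: eq_big => [a|a _].
    by apply/forallP => v; rewrite /reached inE orbT.
  rewrite [X in _ * X]big_pred0 ?mulr1 => [|v]; last by rewrite inE.
  by apply: eq_bigl => v; rewrite inE.
elim: n => [_|n IH lt].
  exists set0; split; [exact: cards0 | by move=> v; rewrite inE | exact: partial_expansion0].
have [S [cS clS eS]] := IH (ltnW lt).
have [w0 w0S] : exists w, w \in ~: S.
  by apply/set0Pn; rewrite -card_gt0 cardsCs setCK cS subn_gt0.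
(* A vertex of least depth outside [S] is the root or has its parent in [S]. *)
case: (@arg_minnP _ w0 (mem (~: S)) (@depth T) w0S) => w; rewrite /= inE => wS min.
have rw : reached S w.
  rewrite /reached; have [//|nr /=] := eqVneq w rt_root.
  apply: contraT => pS; have := min (parent w); rewrite /= inE pS => /(_ isT).
  by rewrite (depth_parent nr) ltnn.
exists (w |: S); split; first by rewrite cardsU1 wS cS.
  move=> v; rewrite /reached !inE => /orP[/eqP ->|/clS].
    by move: rw; rewrite /reached; case/orP=> -> //; rewrite !orbT.
  by rewrite /reached; case/orP=> -> //; rewrite !orbT.
by rewrite partial_expansion_step.
Qed.
End TreeExpansion.

(** * Spanning families of nested subspaces *)

Section Families.
Variables (K : fieldType) (T : rooted_tree) (d : leaf T -> nat) (r : rank_seq T).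
Local Notation family := (forall v : T, nat -> subtree_tensors K d v).

(** Coordinates are padded by zeros beyond [\dim U], so that exactly [n] summands occur. *)
Lemma vspace_combination (V : vectType K) (U : {vspace V}) n x :
  (\dim U <= n)%N -> x \in U -> exists c : nat -> K, x = \sum_(i < n) c i *: (vbasis U)`_i.
Proof.
move=> le xU.
exists (fun i => if insub i is Some i' then coord (vbasis U) i' x else 0).
transitivity (\sum_(i < n | (i < \dim U)%N)
  (if insub (val i) is Some i' then coord (vbasis U) i' x else 0) *: (vbasis U)`_i).
  rewrite -(big_ord_widen n (fun i => (if insub i is Some i' then coord (vbasis U) i' x else 0) *: (vbasis U)`_i) le).
  by rewrite {1}(coord_vbasis xU); apply: eq_bigr => i _; rewrite valK.
rewrite [RHS](bigID (fun i : 'I_n => (i < \dim U)%N)) /= [X in _ + X]big1 ?addr0 // => i /negPf lt.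
by rewrite insubF // scale0r.
Qed.

Lemma pure_tensor_sum (v : T) (b : family) (e : child v -> nat -> K) :
  pure_tensor (fun u : child v => \sum_(a < r (val u)) e u a *: b (val u) a) =
  \sum_(k : kid_index r v) (\prod_u e u (k u)) *: pure_tensor (fun u => b (val u) (k u)).
Proof.
apply/ffunP => j; rewrite ffunE sum_ffunE.
under eq_bigr do rewrite sum_ffunE.
rewrite (prod_sum_multi_index (n := fun u : child v => r (val u))
  (fun u a => (e u a *: b (val u) a) (restrict_child u j))).
apply: eq_bigr => k _; rewrite !ffunE -[RHS]big_split.
by apply: eq_bigr => u _; rewrite ffunE.
Qed.

(** [b v] lists a basis of [U v] followed by zeros. Nestedness writes [b v i] through pure tensors,
    and expanding their factors in the bases at the children gives [C]. *)
Lemma ttn_families (U : forall v, {vspace subtree_tensors K d v}) :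
  (forall v, (\dim (U v) <= r v)%N) ->
  (forall v, ~~ is_leaf v -> forall x, x \in U v ->
     in_tensor_product (fun u : child v => U (val u)) x) ->
  exists (b : family) (C : forall v, nat -> kid_index r v -> K),
    (forall v i, ~~ is_leaf v -> b v i =
       \sum_(k : kid_index r v) C v i k *: pure_tensor (fun u => b (val u) (k u))) /\
    (forall x, x \in U rt_root -> exists c, x = c *: b rt_root 0).
Proof.
move=> dimU nest; pose b v i : subtree_tensors K d v := (vbasis (U v))`_i.
have bU v i : b v i \in U v.
  have [lt|ge] := ltnP i (size (vbasis (U v))); first exact/vbasis_mem/mem_nth.
  by rewrite /b nth_default ?mem0v.
have main v i : exists C : kid_index r v -> K, ~~ is_leaf v -> b v i =
    \sum_k C k *: pure_tensor (fun u => b (val u) (k u)).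
  have [lf|nl] := boolP (is_leaf v); first by exists (fun _ => 0).
  have [n [c [t [tU ->]]]] := nest v nl _ (bU v i).
  have [e eP] := fin_all_exists (fun m => fin_all_exists (fun u =>
    vspace_combination (dimU (val u)) (tU m u))).
  exists (fun k : kid_index r v => \sum_m c m * \prod_u e m u (k u)) => _.
  transitivity (\sum_(m < n) c m *: \sum_(k : kid_index r v) (\prod_u e m u (k u)) *:
      pure_tensor (fun u => b (val u) (k u))).
    apply: eq_bigr => m _; rewrite -pure_tensor_sum; congr (_ *: _).
    by apply/ffunP => j; rewrite !ffunE; apply: eq_bigr => u _; rewrite {1}eP.
  under eq_bigr do rewrite scaler_sumr; rewrite exchange_big /=; apply: eq_bigr => k _.
  by rewrite scaler_suml; apply: eq_bigr => m _; rewrite scalerA.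
pose C v := boolp.choice (main v).
exists b, (fun v => projT1 (C v)); split=> [v i|x xU]; first exact: (projT2 (C v)).
have := dimU rt_root; rewrite rank_root => le1.
by have [c ->] := vspace_combination le1 xU; exists (c 0%N); rewrite big_ord1.
Qed.

(** An instance of the tree expansion in which the value at a leaf serves as its own coefficient. *)
Lemma family_expansion (b : family) (C : forall v, nat -> kid_index r v -> K) (x : multi_index d) :
  (forall v i, ~~ is_leaf v -> b v i =
     \sum_(k : kid_index r v) C v i k *: pure_tensor (fun u => b (val u) (k u))) ->
  b rt_root 0 (res rt_root x) = \sum_(a : multi_index r)
    \prod_v (if is_leaf v then b v (a v) (res v x) else C v (a v) (kids v a)).
Proof.
move=> bC; apply: (@tree_expansion K T r (fun v i => b v i (res v x))
  (fun v i k => if is_leaf v then b v i (res v x) else C v i k)) => v i.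
have [lf|nl] := boolP (is_leaf v); last first.
  rewrite {1}bC // sum_ffunE; apply: eq_bigr => k _; rewrite !ffunE; congr (_ * _).
  by apply: eq_bigr => u _; rewrite restrict_res.
pose k0 : kid_index r v := finfun (fun u : child v => Ordinal (rank_pos r (val u))).
rewrite (big_pred1 k0) => [|k].
  by rewrite big1 ?mulr1 // => u; case: (leaf_no_child lf u).
by apply/esym/eqP/ffunP => u; case: (leaf_no_child lf u).
Qed.
End Families.

(** * Representation of a tree tensor network *)

Section EdgeProducts.
Variables (K : fieldType) (T : rooted_tree) (d : leaf T -> nat) (r : rank_seq T).
Local Notation S := (associated_tree d r).

Lemma prod_svertex (F : svertex T -> K) :
  \prod_s F s = (\prod_l F (Leaf l)) * (\prod_v F (Inner v)) * \prod_h F (Rank h).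
Proof.
rewrite (reindex (@svertex_from T)) /=; last first.
  by exists (@svertex_to T) => [[[x|x]|x]|x] // _; case: x.
by rewrite !big_sumType.
Qed.

(** Each edge contains exactly one rank node, so it can be oriented from that node and the product
    grouped by rank nodes; the symmetry of [G] absorbs the change of orientation. *)
Lemma prod_edges (G : svertex T -> svertex T -> K) : (forall s t, G s t = G t s) ->
  \prod_(e in edges S) G e.1 e.2 =
  \prod_(h : nonroot T)
    ((\prod_(l : leaf T | val l == val h) G (Rank h) (Leaf l)) *
     \prod_(v : inner T | (val h == val v) || (val h \in children (val v))) G (Rank h) (Inner v)).
Proof.
move=> Gsym.
have oe (s t : svertex T) : on_edge s t -> ~~ on_edge t s.
  by case: s => // h; case: t.
have oe_irr (s : svertex T) : ~~ on_edge s s by case: s.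
transitivity (\prod_(e : svertex T * svertex T | on_edge e.1 e.2) G e.1 e.2).
  pose lt (e : S * S) := (enum_rank e.1 < enum_rank e.2)%N.
  rewrite (bigID (fun e : S * S => on_edge e.1 e.2)) [RHS](bigID lt) /=; congr (_ * _).
    by apply: eq_bigl => -[s t]; rewrite inE /= /sadj /lt /=; case: on_edge => //=; rewrite ?andbF ?andbT.
  rewrite (reindex_inj (h := fun e : S * S => (e.2, e.1))) /=; last by move=> [? ?] [? ?] [-> ->].
  apply: eq_big => [[s t]|[s t] _] //=.
  rewrite inE /= /sadj /lt /= -leqNgt.
  have [st|nst] := boolP (on_edge s t); last first.
    by case ts: (on_edge t s); rewrite ?andbF // (negPf (oe _ _ ts)).
  rewrite orbT (oe _ _ st) andbT andTb ltn_neqAle andTb.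
  suff /negPf ne : t != s by rewrite (inj_eq val_inj) (inj_eq enum_rank_inj) ne.
  by apply: contraTneq st => ->; apply: oe_irr.
rewrite -(pair_big_dep xpredT (fun s t : svertex T => on_edge s t) G) /=.
rewrite prod_svertex [X in X * _ * _]big1 => [|l _]; last by rewrite big_pred0.
rewrite [X in _ * X * _]big1 => [|v _]; last by rewrite big_pred0.
rewrite !mul1r; apply: eq_bigr => h _.
rewrite big_mkcond prod_svertex [X in _ * X]big1 ?mulr1 //; congr (_ * _).
  rewrite [RHS]big_mkcond; apply: eq_bigr => l _ /=; congr (if _ then _ else _).
  rewrite !(inj_eq Some_inj); case: eqP => //= _; apply/negP => /eqP e.
  have : val h \in children (val l) by rewrite inE (valP h) /=; apply/eqP/esym.
  by have /eqP -> := valP l; rewrite inE.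
rewrite [RHS]big_mkcond; apply: eq_bigr => v _ /=; congr (if _ then _ else _).
by rewrite !(inj_eq Some_inj) inE (valP h) [val v == val h]eq_sym [parent _ == _]eq_sym.
Qed.
End EdgeProducts.

Section Representation.
Variables (K : fieldType) (T : rooted_tree) (d : leaf T -> nat) (r : rank_seq T).
Local Notation S := (associated_tree d r).
Local Notation sindex := (multi_index (@space_dim S)).
Local Notation node_dim v := ((\prod_(u in children v) r u) * r v)%N.

(** The dimension at an inner vertex counts the pairs of an index family for its children and an
    index for itself, so one basis vector there can encode such a pair. *)
Lemma card_node_index (v : T) : #|{: kid_index r v * 'I_(r v)}| = node_dim v.
Proof.
rewrite card_prod card_multi_index card_ord; congr (_ * _)%N.
by rewrite (big_sub (children v)).
Qed.

Definition decode (v : T) (n : 'I_(node_dim v)) : kid_index r v * 'I_(r v) :=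
  enum_val (cast_ord (esym (card_node_index v)) n).

Definition encode (v : T) (x : kid_index r v * 'I_(r v)) : 'I_(node_dim v) :=
  cast_ord (card_node_index v) (enum_rank x).

Lemma encodeK v : cancel (@encode v) (@decode v).
Proof. by move=> x; rewrite /decode /encode cast_ordK enum_rankK. Qed.

Lemma decodeK v : cancel (@decode v) (@encode v).
Proof. by move=> x; rewrite /decode /encode enum_valK cast_ordKV. Qed.

Variables (b : forall v : T, nat -> subtree_tensors K d v)
  (C : forall v, nat -> kid_index r v -> K) (first : forall v : inner T, child (val v)).

Definition leaf_self (l : leaf T) : leaf_below (val l) :=
  exist _ l (connect0 (frel (@parent T)) (val l)).

(** A leaf has only itself below it, so the sum has a single term; summing avoids turning [i] into a
    multi-index of the one-leaf subtree. *)
Definition leaf_entry (l : leaf T) (i : 'I_(d l)) (a : nat) : K :=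
  \sum_(j : multi_index (@below_dim T d (val l)) | j (leaf_self l) == i :> 'I_(d l))
    b (val l) a j.

Lemma leaf_entry_res (x : multi_index d) l a :
  leaf_entry (x l) a = b (val l) a (res (val l) x).
Proof.
rewrite /leaf_entry (big_pred1 (res (val l) x)) // => j.
apply/eqP/eqP => [e|->]; last by rewrite ffunE.
apply/ffunP => k; have -> : k = leaf_self l; last by rewrite e ffunE.
apply/val_inj/val_inj => /=; apply/eqP; apply: contraT => ne.
have [u _] := below_childP (valP k) ne.
by case: (leaf_no_child (valP l) u).
Qed.

(* Every inner vertex v stores its coefficient on the single edge to first v,
   since the root has no edge to a parent; all other entries at v are deltas. *)
Definition inner_entry (v : inner T) (n : 'I_(node_dim (val v))) (h : nonroot T) (a : nat) : K :=
  if val h == val v then ((decode n).2 == a :> nat)%:R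
  else if insub (val h) is Some u then
    ((decode n).1 u == a :> nat)%:R *
    (if u == first v then C (decode n).2 (decode n).1 else 1)
  else 0.

Definition rank_edge_mx (s : svertex T) (h : nonroot T) :
  'M[K]_(sdim d r s, r (val h)) :=
  match s return 'M[K]_(sdim d r s, r (val h)) with
  | Leaf l => \matrix_(i, a) if val l == val h then leaf_entry i a else 0
  | Inner v => \matrix_(n, a) inner_entry n h a
  | Rank _ => 0
  end.

(** Matching on both vertices lets the dimensions reduce in each case; a matrix out of a rank node
    is the transpose of the one into it. *)
Definition ttn_mx (s t : svertex T) : 'M[K]_(sdim d r s, sdim d r t) :=
  match t return 'M[K]_(sdim d r s, sdim d r t) with
  | Rank h => rank_edge_mx s h
  | Leaf l => match s return 'M[K]_(sdim d r s, sdim d r (Leaf l)) with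
    | Rank h => (rank_edge_mx (Leaf l) h)^T | _ => 0 end
  | Inner v => match s return 'M[K]_(sdim d r s, sdim d r (Inner v)) with
    | Rank h => (rank_edge_mx (Inner v) h)^T | _ => 0 end
  end.

Lemma ttn_mx_sym s t : ttn_mx t s = (ttn_mx s t)^T.
Proof.
by case: s => [l|v|h]; case: t => [l'|v'|h'] /=; rewrite ?trmx0 ?trmxK.
Qed.

Lemma rank_edge_mx_zero s h : ~~ sadj s (Rank h) -> rank_edge_mx s h = 0.
Proof.
case: s => [l|v|k] //=; rewrite /sadj /= !(inj_eq Some_inj) negb_or => /andP[n1 n2].
  by apply/matrixP => i a; rewrite !mxE (negPf n1).
apply/matrixP => i a; rewrite !mxE /inner_entry eq_sym (negPf n1).
by rewrite insubF // inE eq_sym [_ == val v]eq_sym (negPf n2) andbF.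
Qed.

Lemma ttn_mx_zero s t : ~~ sadj s t -> ttn_mx s t = 0.
Proof.
case: t => [l|v|h] st /=; last exact: rank_edge_mx_zero.
- by case: s st => // h; rewrite sadj_sym => /rank_edge_mx_zero /= ->; rewrite trmx0.
- by case: s st => // h; rewrite sadj_sym => /rank_edge_mx_zero /= ->; rewrite trmx0.
Qed.

Definition ttn_rep : rep K S := @Rep K S ttn_mx ttn_mx_sym ttn_mx_zero.

Lemma edge_prod_ttn_rep (j : sindex) : edge_prod ttn_rep j =
  \prod_(h : nonroot T)
    ((\prod_(l : leaf T | val l == val h)
        leaf_entry (j (Leaf l : S) : 'I_(d l)) (j (Rank h : S) : 'I_(r (val h)))) *
     \prod_(v : inner T | (val h == val v) || (val h \in children (val v)))
        inner_entry (j (Inner v : S) : 'I_(node_dim (val v))) h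
          (j (Rank h : S) : 'I_(r (val h)))).
Proof.
rewrite /edge_prod (@prod_edges K T d r (fun s t : S => ttn_rep s t (j s) (j t))); last first.
  by move=> s t; rewrite rep_sym mxE.
apply: eq_bigr => h _; congr (_ * _); apply: eq_bigr => s; last by rewrite /= !mxE.
by move=> /eqP e; rewrite /= !mxE e eqxx.
Qed.

(** The index at an inner vertex is the one forced by the deltas: it encodes the rank indices around
    that vertex. *)
Definition spread (x : multi_index d) (a : multi_index r) : sindex :=
  finfun (fun s : svertex T => match s return 'I_(sdim d r s) with
  | Leaf l => x l
  | Inner v => encode (kids (val v) a, a (val v))
  | Rank h => a (val h) end).

(** The root has no rank node above it; its only index is 0, since [r] is 1 there. *)
Definition rank_part (j : sindex) : multi_index r :=
  finfun (fun v : T => match boolP (v != rt_root) with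
  | AltTrue h => j (Rank (mk_nonroot h) : S) : 'I_(r v)
  | AltFalse _ => Ordinal (rank_pos r v) end).

Lemma rank_partE j (h : nonroot T) : rank_part j (val h) = j (Rank h : S) :> 'I_(r (val h)).
Proof.
rewrite ffunE; case: {-}_ / boolP => nr; last by case/negP: nr; exact: (valP h).
by case: h nr => h h0 nr; rewrite /mk_nonroot /= (bool_irrelevance nr h0).
Qed.

Lemma spreadK x : cancel (spread x) rank_part.
Proof.
move=> a; apply/ffunP => v; have [e|nr] := eqVneq v rt_root; last first.
  by rewrite (rank_partE _ (mk_nonroot nr)) ffunE.
apply/val_inj; move: (rank_part _ v) (a v); rewrite e rank_root => c c'.
by rewrite !ord1.
Qed.

(* Only the indices of the form spread x a contribute, by the delta entries. *)
Lemma rank_partK x j : compatible j x -> edge_prod ttn_rep j != 0 ->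
  spread x (rank_part j) = j.
Proof.
move=> /forallP jx; rewrite edge_prod_ttn_rep => /prodf_neq0 nz.
apply/ffunP; case=> [l|v|h]; rewrite ffunE.
- by rewrite (eqP (jx l)).
- have innz (h : nonroot T) : (val h == val v) || (val h \in children (val v)) ->
      inner_entry (j (Inner v : S) : 'I_(node_dim (val v))) h
        (j (Rank h : S) : 'I_(r (val h))) != 0.
    by move=> hv; have := nz h isT; rewrite mulf_eq0 negb_or => /andP[_ /prodf_neq0]; apply.
  rewrite -[RHS]decodeK; congr encode; rewrite [RHS]surjective_pairing; congr (_, _).
    apply/ffunP => u; have [nu pu] := childP u; pose h := mk_nonroot nu.
    have ne : val u != val v by rewrite -[X in _ != X]pu eq_sym parent_neq.
    have := innz h; rewrite /inner_entry (valP u) orbT => /(_ isT).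
    rewrite /= (negPf ne) valK mulf_eq0 negb_or => /andP[+ _].
    case: (@eqP nat) => [e _|_]; last by rewrite eqxx.
    by apply/val_inj; rewrite ffunE (rank_partE j h).
  have [e|nr] := eqVneq (val v) rt_root.
    apply/val_inj; move: (rank_part j (val v)) (decode _).2; rewrite e rank_root => c c'.
    by rewrite !ord1.
  have := innz (mk_nonroot nr); rewrite /inner_entry eqxx => /(_ isT).
  case: (@eqP nat) => [e _|_]; last by rewrite eqxx.
  by apply/val_inj; rewrite (rank_partE j (mk_nonroot nr)).
- exact: rank_partE.
Qed.

Lemma edge_prod_spread (hroot : (2 <= #|children (@rt_root T)|)%N) x a :
  edge_prod ttn_rep (spread x a) =
  \prod_v (if is_leaf v then b v (a v) (res v x) else C (a v) (kids v a)).
Proof.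
rewrite edge_prod_ttn_rep big_split /=.
(* Regroup from rank nodes to vertices of the rooted tree: each edge factor is counted at its tree
   vertex. *)
rewrite (exchange_big_dep xpredT) //= [X in _ * X](exchange_big_dep xpredT) //=.
rewrite [RHS](bigID (@is_leaf T)) /=; congr (_ * _).
  rewrite [RHS](big_sub (@is_leaf T)) /=; apply: eq_bigr => l _.
  have nr : val l != rt_root.
    by apply: contraTneq hroot => <-; have /eqP -> := valP l; rewrite cards0.
  rewrite (big_pred1 (mk_nonroot nr)) => [|h]; last first.
    by rewrite eq_sym; apply/eqP/eqP => [e|-> //]; apply: val_inj.
  by rewrite !ffunE leaf_entry_res (valP l).
rewrite [RHS](big_sub (fun v => ~~ is_leaf v)) /=; apply: eq_bigr => v _.
have [nu pu] := childP (first v).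
have ne : val (first v) != val v by rewrite -[X in _ != X]pu eq_sym parent_neq.
(* The edge to [first v] contributes [C]; the factors on all other edges at [v] are deltas equal to
   1. *)
rewrite (negPf (valP v)) (bigD1 (mk_nonroot nu)) /=; last by rewrite (valP (first v)) orbT.
rewrite big1 ?mulr1 => [|h /andP[hv hu]].
  by rewrite !ffunE /inner_entry /= (negPf ne) valK !encodeK /= ffunE !eqxx mul1r.
rewrite !ffunE /inner_entry encodeK /=; case: eqP hv => [-> _|_ /= hv]; first by rewrite eqxx.
rewrite insubT /= ffunE eqxx mul1r; case: eqP => // e; case/eqP: hu; apply: val_inj.
by rewrite /= -e.
Qed.

Lemma leaf_contraction_ttn_rep (hroot : (2 <= #|children (@rt_root T)|)%N) x :
  leaf_contraction ttn_rep x = \sum_(a : multi_index r)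
    \prod_v (if is_leaf v then b v (a v) (res v x) else C (a v) (kids v a)).
Proof.
rewrite ffunE (bigID (fun j => spread x (rank_part j) == j)) /= addrC big1 ?add0r => [|j].
  rewrite (reindex_onto (spread x) rank_part) => [|j /andP[_ /eqP]] //.
  apply: eq_big => [a|a _]; last exact: edge_prod_spread.
  rewrite !spreadK !eqxx !andbT; apply/forallP => l; by rewrite ffunE.
case/andP=> jx; apply: contraNeq; by move=> nz; apply/eqP/rank_partK.
Qed.
End Representation.

(** * The two inclusions *)

Lemma ttn_in_range (K : fieldType) (T : rooted_tree) (d : leaf T -> nat)
  (r : rank_seq T) (hroot : (2 <= #|children (@rt_root T)|)%N) (p : proj (tensors K d)) :
  ttn K d r p -> exists A : rep K (associated_tree d r), val p = <[leaf_contraction A]>%VS.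
Proof.
case=> U [dimU nest [psi psiU ep]].
have [b [C [bC spanU]]] := ttn_families dimU nest.
have first (v : inner T) : child (val v).
  by have /set0Pn/sigW[u hu] := valP v; exists u.
exists (ttn_rep b C first).
have -> : leaf_contraction (ttn_rep b C first) = of_root (b rt_root 0%N).
  by apply/ffunP => x; rewrite leaf_contraction_ttn_rep // ffunE -(family_expansion x bC).
have [c epsi] := spanU psi psiU.
have eo : of_root psi = c *: of_root (b rt_root 0%N).
  by apply/ffunP => x; rewrite epsi !ffunE.
(* The scalar is nonzero because [p] is a line. *)
rewrite ep eo; have nz : c != 0.
  by apply/eqP => c0; have := valP p; rewrite ep eo c0 scale0r dim_vline eqxx.
apply/eqP; rewrite eqEsubv -!memvE memvZ ?memv_line //=.
by rewrite -[X in X \in _](scalerK nz) memvZ ?memv_line.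
Qed.

Lemma sub_zariski_closure (K : fieldType) (I : finType) (S : set {ffun I -> K^o}) x :
  S x -> zariski_closure S x.
Proof. by move=> Sx p; apply. Qed.

Local Open Scope classical_set_scope.

Theorem theorem1p2 (R : realType) (T : rooted_tree)
  (hroot : (2 <= #|children (@rt_root T)|)%N)
  (d : leaf T -> nat) (hd : forall l, (0 < d l)%N)
  (r : rank_seq T) (hr : admissible d r) :
  proj_leaf_iso R[i] hroot @` ttn R[i] d r =
  markov_model R[i] (associated_tree d r).
Proof.
(* The first inclusion needs no limit: the point is spanned by a contraction. *)
apply/seteqP; split=> [_ [p /(ttn_in_range hroot)[A ep] <-]|q [x clx eq]].
  exists (contraction A); first by apply: sub_zariski_closure; exists A.
  by rewrite /= ep limg_line -contractionE.
(* Conversely, a point of the closure comes from some [w] in W whose minors vanish; [w] is nonzero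
   because [q] is a line. *)
have : x \in limg (leaf_iso R[i] d r hroot) by rewrite leaf_iso_surj memvf.
case/memv_imgP=> w _ ex; rewrite ex in clx eq.
have nw : \dim <[w]>%VS == 1%N.
  have := valP q; rewrite eq !dim_vline; case: (eqVneq w 0) => // ->.
  by rewrite linear0 eqxx.
exists (exist _ <[w]>%VS nw : proj _).
  by apply: (@ttn_of_minors _ _ _ w) => //; apply: minors_closure clx.
by apply: val_inj; rewrite /= limg_line eq.
Qed.
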